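(* Let $t\geq 2$ be a positive integer and let $(F_i)_{i\geq 0}=(0,1,1,2,3,5,8,13,\ldots)$ be the Fibonacci numbers. For $(t,t+1)$-core partitions with distinct parts, the following hold. (1) The number of such partitions is $F_{t+1}$. (2) The largest size of such partitions is $\left[\frac13\binom{t+1}{2}\right]$, where $[x]$ is the largest integer not greater than $x$. (3) The number of such partitions with the largest size is $2$ if $t\equiv 1 \pmod 3$ and $1$ otherwise. (4) The total sum of the sizes of these partitions and the average size are, respectively, given by $$\sum_{\substack{i+j+k=t+1\\ i,j,k\geq 1}}F_iF_jF_k\qquad\text{and}\qquad \sum_{\substack{i+j+k=t+1\\ i,j,k\geq 1}}\frac{F_iF_jF_k}{F_{t+1}}.$$
   Context: The Fibonacci numbers satisfy $F_0=0$, $F_1=1$, $F_{i}=F_{i-1}+F_{i-2}$ for $i\geq 2$. A partition is a finite nonincreasing sequence $\lambda=(\lambda_1,\lambda_2,\ldots,\lambda_\ell)$ of positive integers (the empty partition, $\ell=0$, is included); the $\lambda_i$ are its parts and $|\lambda|=\sum_{i=1}^{\ell}\lambda_i$ is its size. A partition has distinct parts if no two of its parts are equal. $\lambda$ is identified with its Young diagram, the collection of left-justified rows with $\lambda_i$ boxes in the $i$-th row. The hook length $h(i,j)$ of the box $(i,j)$ in the $i$-th row and $j$-th column is the number of boxes that are exactly to the right of it (same row), or exactly below it (same column), or the box itself. A partition is a $(t_1,\ldots,t_m)$-core partition if none of its boxes has hook length in $\{t_1,\ldots,t_m\}$; in particular a $(t,t+1)$-core partition has no hook length equal to $t$ or $t+1$.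 *)

(* Defs.v *)
From mathcomp Require Import all_boot all_order all_algebra.
From mathcomp Require Import finmap.

Set Implicit Arguments.
Unset Strict Implicit.
Unset Printing Implicit Defensive.

Fixpoint fib (n : nat) : nat :=
  match n with
  | 0 => 0
  | 1 => 1
  | (m.+1 as p).+1 => fib p + fib m
  end.

Definition is_partition (la : seq nat) : bool :=
  sorted geq la && all (leq 1) la.

(* Rows and columns are numbered from 0. *)
Definition young_diagram (la : seq nat) : seq (nat * nat) :=
  [seq (i, j) | i <- iota 0 (size la), j <- iota 0 (nth 0 la i)].

Definition in_hook (b c : nat * nat) : bool :=
  [|| (c.1 == b.1) && (b.2 < c.2),
      (c.2 == b.2) && (b.1 < c.1)
    | c == b].

Definition hook_length (la : seq nat) (b : nat * nat) : nat :=
  count (in_hook b) (young_diagram la).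

Definition is_core (ts : seq nat) (la : seq nat) : bool :=
  all (fun b => hook_length la b \notin ts) (young_diagram la).

Definition distinct_core (t : nat) (la : seq nat) : bool :=
  [&& is_partition la, uniq la & is_core [:: t; t.+1] la].

(* Main.v *)
Require Import Defs.
From mathcomp Require Import all_boot all_order all_algebra.
From mathcomp Require Import finmap.
From mathcomp Require Import zify.

Set Implicit Arguments.
Unset Strict Implicit.
Unset Printing Implicit Defensive.

(** The theorem rests on a description of the partitions in question that does
not mention hooks: a partition with distinct parts is a (t, t+1)-core exactly
when its largest part plus its number of parts is at most t. Indeed, moving
one box to the right in the first row lowers the hook length by 1, plus the
number of parts ending in the column just left, and distinctness of the parts
makes this number at most 1. The hook lengths of the first row thus go down to
1 in steps of 1 or 2, so they cannot jump over both t and t+1, and if the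
first of them were at least t, one would be equal to t or t+1. This first
hook length is the largest in the diagram, and it is the largest part plus the
number of parts minus 1. See [short_strict_of_core], [core_of_short_strict].

For the enumeration, split the admissible partitions for t+2 by whether the
bound t+2 is attained. If not, the partition is admissible for t+1; if so, its
first part is determined by the rest, which can be any partition mu admissible
for t. Hence the Fibonacci count [size_short_stricts]. Writing F for the
Fibonacci sequence and * for convolution, the same splitting gives the total
number of parts (F * F)(t); as for the sizes, the first part t+1-l(mu), where
l(mu) is the number of parts of mu, sums over all mu to
(t+1) F(t+1) - (F * F)(t), which is (F * F)(t+2) by [fib_conv_fibE]. So the
total size obeys the recurrence of F * F * F and equals it at t+1
([sum_sumn_short_stricts]).

For the largest size, an admissible partition with l parts is bounded part by
part by the staircase t-l, t-l-1, ..., t-2l+1, of size l(2t+1-3l)/2, and has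
that size only if it is this staircase. Twenty-four times the size is
(2t+1)^2 - (6l-2t-1)^2, so the best l are those minimising |6l-(2t+1)|: the
minimum is 1, reached once, when 2t+1 is prime to 3, and it is 3, reached by
two consecutive l, when t is 1 mod 3. In all cases the best values are (t+1)/3
and (t+2)/3, rounded down ([staircase_optimum]). *)

(** * Hook lengths and the cores with distinct parts *)

Definition short_strict (t : nat) (la : seq nat) : bool :=
  [&& sorted gtn la, all (leq 1) la & head 0 la + size la <= t].

Lemma hook_length_rows (la : seq nat) (b : nat * nat) :
  hook_length la b =
  \sum_(i < size la) count (fun j => in_hook b (nat_of_ord i, j))
                           (iota 0 (nth 0 la i)).
Proof.
rewrite /hook_length /young_diagram count_flatten -map_comp sumnE big_map.
rewrite -[in iota 0 _](subn0 (size la)) -/(index_iota 0 _) big_mkord.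
by apply: eq_bigr => i _ /=; rewrite count_map.
Qed.

(** A row strictly below a box meets its hook in at most one box, the one in
the same column. *)
Lemma count_hook_row (j n : nat) (b : nat * nat) :
  b.1 < n -> count (fun c => in_hook b (n, c)) (iota 0 j) = (b.2 < j).
Proof.
case: b => r c /= rn.
have -> : (c < j) = (c \in iota 0 j) by rewrite mem_iota.
rewrite -count_uniq_mem ?iota_uniq //.
apply: eq_count => d /=; rewrite /in_hook /= xpair_eqE.
by rewrite rn gtn_eqF //= andbT orbF.
Qed.

Lemma hook_length_first_row (a j : nat) (mu : seq nat) :
  hook_length (a :: mu) (0, j) = (a - j) + count (ltn j) mu.
Proof.
rewrite hook_length_rows big_ord_recl; congr (_ + _).
  rewrite /= (_ : count _ _ = count (leq j) (iota 0 a)); last first.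
    by apply: eq_count => c; rewrite /in_hook /= xpair_eqE eqxx /= andbF; lia.
  elim: a => [|a IH]; first by rewrite sub0n.
  by rewrite -addn1 iotaD count_cat IH /=; lia.
rewrite -sum1_count [RHS](big_nth 0) big_mkord [RHS]big_mkcond.
by apply: eq_bigr => i _; rewrite count_hook_row.
Qed.

(** A crude bound, with the whole row of the box in place of its arm; it is
sharp for the corner box, which is all that matters here. *)
Lemma hook_length_bound (la : seq nat) (b : nat * nat) :
  b.1 < size la -> hook_length la b <= nth 0 la b.1 + (size la).-1.
Proof.
move=> lt_b; rewrite hook_length_rows (bigD1 (Ordinal lt_b)) //=.
apply: leq_add; first by rewrite (leq_trans (count_size _ _)) ?size_iota.
rewrite -[X in _ <= X.-1]card_ord -(cardC1 (Ordinal lt_b)) -sum1_card.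
rewrite [leqRHS](eq_bigl (fun i => i != Ordinal lt_b)) //.
apply: leq_sum => i; rewrite -val_eqE /= neq_ltn => /orP[lt|gt]; last first.
  by rewrite count_hook_row // leq_b1.
rewrite (_ : count _ _ = 0) // -[RHS](count_pred0 (iota 0 (nth 0 la i))).
apply: eq_count => c; case: b lt {lt_b} => r s /= lt.
by rewrite /in_hook /= xpair_eqE; lia.
Qed.

Lemma core_of_short_strict (t : nat) (la : seq nat) :
  short_strict t la -> is_core [:: t; t.+1] la.
Proof.
case/and3P=> lasort _ lat; apply/allP => b /allpairsPdep[i [j []]].
rewrite !mem_iota /= add0n => lti _ ->.
have := @hook_length_bound la (i, j) lti; rewrite /=.
have le_i : nth 0 la i <= head 0 la.
  case: la lasort {lat} lti => // a mu /= pa.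
  case: i => [//|i] lti; rewrite /=.
  have /allP/(_ _ (mem_nth 0 (lti : i < size mu))) :=
    order_path_min (rev_trans ltn_trans) pa.
  by rewrite /=; lia.
rewrite !inE; lia.
Qed.

(** The columns j and j+1 differ in height by the number of parts equal to
j+1: this is where distinctness of the parts enters. *)
Lemma count_ltn_strict_step (j : nat) (mu : seq nat) :
  uniq mu -> count (ltn j) mu <= (count (ltn j.+1) mu).+1.
Proof.
move=> umu; apply: (@leq_trans (count (predU (ltn j.+1) (pred1 j.+1)) mu)).
  by apply: sub_count => c /=; lia.
have := count_predUI (ltn j.+1) (pred1 j.+1) mu.
rewrite count_uniq_mem //; have := leq_b1 (j.+1 \in mu); lia.
Qed.

(** If the corner hook were at least t, a discrete continuity argument along
the first row would keep all its hook lengths above t+1, although the last one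
is 1. *)
Lemma short_strict_of_core (t : nat) (la : seq nat) : 0 < t ->
  sorted gtn la -> all (leq 1) la -> is_core [:: t; t.+1] la ->
  short_strict t la.
Proof.
move=> t0 lasort lapos lacore; apply/and3P; split=> //.
case: la lasort lapos lacore => [|a mu] //= pa /andP[a0 mupos] core.
rewrite leqNgt; apply/negP => big.
have umu : uniq mu.
  by have := gtn_sorted_uniq_geq mu; rewrite (path_sorted pa) => /esym/andP[].
have lt_a : all (ltn^~ a) mu by exact: order_path_min (rev_trans ltn_trans) pa.
pose h j := (a - j) + count (ltn j) mu.
have hcore j : j < a -> (h j != t) && (h j != t.+1).
  move=> ltj; have /allP/(_ (0, j)) := core.
  rewrite hook_length_first_row !inE negb_or; apply.
  by apply/allpairsPdep; exists 0, j; rewrite !mem_iota.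
have h_big j : j < a -> t.+1 < h j.
  elim: j => [|j IH] ltj.
    have := hcore _ ltj; rewrite /h subn0 (_ : count _ _ = size mu) //; first lia.
    by apply/eqP; rewrite -all_count.
  have := IH (ltnW ltj); have := hcore _ ltj.
  have := count_ltn_strict_step j umu; rewrite /h; lia.
have := h_big a.-1; rewrite /h.
rewrite (_ : count _ mu = 0); first lia.
apply/eqP; rewrite -leqn0 leqNgt -has_count -all_predC.
by apply: sub_all lt_a => c /=; lia.
Qed.

Lemma distinct_coreE (t : nat) (la : seq nat) : 0 < t ->
  distinct_core t la = short_strict t la.
Proof.
move=> t0; apply/idP/idP.
  case/and3P=> /andP[sla pla] ula core.
  by apply: short_strict_of_core => //; rewrite gtn_sorted_uniq_geq ula.
move=> sla; have core := core_of_short_strict sla.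
case/and3P: sla => sla pla _; move: sla; rewrite gtn_sorted_uniq_geq => /andP[ula sla].
by rewrite /distinct_core /is_partition sla pla ula.
Qed.

(** * Enumeration and Fibonacci count *)

(** In the recursive step, the first part added to mu is the one for which
largest part plus number of parts is exactly t+2. *)
Fixpoint short_stricts (t : nat) : seq (seq nat) :=
  match t with
  | 0 => [:: [::]]
  | 1 => [:: [::]]
  | (m.+1 as p).+1 =>
      short_stricts p ++ [seq (p - size mu) :: mu | mu <- short_stricts m]
  end.

Lemma two_step_ind (P : nat -> Prop) :
  P 0 -> P 1 -> (forall n, P n -> P n.+1 -> P n.+2) -> forall n, P n.
Proof.
move=> P0 P1 PS n; suff [] : P n /\ P n.+1 by [].
by elim: n => // n [? ?]; split; last exact: PS.
Qed.

Lemma short_strict_le1 (t : nat) (la : seq nat) : t <= 1 ->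
  short_strict t la = (la == [::]).
Proof.
move=> t1; case: la => [|a mu]; rewrite /short_strict //=.
by apply/negP => /and3P[_ /andP[a0 _]]; lia.
Qed.

Lemma mem_short_stricts (t : nat) (la : seq nat) :
  (la \in short_stricts t) = short_strict t la.
Proof.
elim/two_step_ind: t la => [la|la|t IH0 IH1 la].
- by rewrite short_strict_le1 // inE.
- by rewrite short_strict_le1 // inE.
rewrite [short_stricts _]/= mem_cat IH1.
apply/orP/idP => [[]|].
- by case/and3P=> ? ? ?; apply/and3P; split=> //; apply: leqW.
- case/mapP=> mu; rewrite IH0 => /and3P[smu pmu hmu] ->.
  rewrite /short_strict /= pmu; apply/and3P; split; last lia; last by lia.
  (* The new first part exceeds the head of mu since head + size <= t. *)
  by case: mu smu hmu {pmu} => //= b mu -> /= h; rewrite andbT; lia.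
case/and3P=> sla pla; rewrite leq_eqVlt => /orP[/eqP hla|hla]; last first.
  by left; apply/and3P.
right; case: la sla pla hla => [//|a mu] /= pa /andP[a0 pmu] hla.
apply/mapP; exists mu; last by congr (_ :: _); lia.
rewrite IH0; apply/and3P; split=> //; first exact: path_sorted pa.
by case: mu pa hla {pmu} => [|b mu] //= /andP[/= ba _]; lia.
Qed.

Lemma uniq_short_stricts (t : nat) : uniq (short_stricts t).
Proof.
elim/two_step_ind: t => // t IH0 IH1.
rewrite [short_stricts _]/= cat_uniq IH1 map_inj_uniq ?IH0; last by move=> ? ? [].
rewrite andbT /=; apply/hasPn => _ /mapP[mu + ->].
(* The two pieces are told apart by whether head + size reaches t+2. *)
rewrite mem_short_stricts => /and3P[_ _ hmu]; apply/negP.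
move=> new; have : (t.+1 - size mu) :: mu \in short_stricts t.+1 := new.
by rewrite mem_short_stricts => /and3P[_ _] /=; lia.
Qed.

Lemma size_short_stricts (t : nat) : size (short_stricts t) = fib t.+1.
Proof.
elim/two_step_ind: t => // t IH0 IH1.
by rewrite [short_stricts _]/= size_cat size_map IH0 IH1.
Qed.

(** * Total size as a triple Fibonacci convolution *)

Definition fib_conv (a : nat -> nat) (n : nat) : nat :=
  \sum_(0 <= i < n.+1) fib i * a (n - i).

(** In terms of generating functions: that of the Fibonacci numbers is
x / (1 - x - x^2), so multiplying by it solves this recurrence. *)
Lemma fib_conv_rec (a : nat -> nat) (n : nat) :
  fib_conv a n.+2 = fib_conv a n.+1 + fib_conv a n + a n.+1.
Proof.
rewrite /fib_conv !big_mkord !(big_ord_recl n.+2) (big_ord_recl n.+1) /=.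
rewrite !mul0n !add0n mul1n /bump /= !add1n subSS subn0.
rewrite addnC; congr (_ + _); rewrite (big_ord_recl n.+1) /= mul0n add0n.
rewrite -big_split /=; apply: eq_bigr => i _.
by rewrite /bump !add1n !subSS -mulnDl.
Qed.

(** This identity converts the sum of the first parts, which involves
(n+1) F(n+1), into a pure convolution. Both sides satisfy the same recurrence
by [fib_conv_rec]. *)
Lemma fib_conv_fibE (n : nat) :
  fib_conv fib n.+2 + fib_conv fib n = n.+1 * fib n.+1.
Proof.
elim/two_step_ind: n => [||n].
- by rewrite /fib_conv unlock.
- by rewrite /fib_conv unlock.
rewrite (fib_conv_rec _ n.+2) (fib_conv_rec _ n) => IH0 IH1.
rewrite (_ : fib n.+3 = fib n.+2 + fib n.+1) //.
have : fib n.+2 = fib n.+1 + fib n by [].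
nia.
Qed.

Lemma sum_size_short_stricts (t : nat) :
  \sum_(la <- short_stricts t) size la = fib_conv fib t.
Proof.
elim/two_step_ind: t => [||t IH0 IH1].
- by rewrite big_seq1 /fib_conv unlock.
- by rewrite big_seq1 /fib_conv unlock.
rewrite [short_stricts _]/= big_cat big_map /= IH1.
under eq_bigr do rewrite -add1n.
by rewrite big_split /= IH0 sum1_size size_short_stricts fib_conv_rec; lia.
Qed.

Lemma sum_sumn_short_stricts (t : nat) :
  \sum_(la <- short_stricts t) sumn la = fib_conv (fib_conv fib) t.+1.
Proof.
elim/two_step_ind: t => [||t IH0 IH1].
- by rewrite big_seq1 /fib_conv unlock.
- by rewrite big_seq1 /fib_conv unlock.
rewrite [short_stricts _]/= big_cat big_map /= IH1.
rewrite big_split /= IH0 (fib_conv_rec _ t.+1).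
suff -> : \sum_(mu <- short_stricts t) (t.+1 - size mu) = fib_conv fib t.+2 by lia.
(* Adding the number of parts of each mu turns every summand into t+1. *)
apply: (@addIn (fib_conv fib t)); rewrite fib_conv_fibE -sum_size_short_stricts.
rewrite -size_short_stricts -sum1_size big_distrr -big_split /=.
rewrite !big_seq; apply: eq_bigr => mu; rewrite mem_short_stricts => /and3P[_ _ h].
by rewrite subnK ?muln1 //; lia.
Qed.

(** Ranges starting at 1 and truncated at a bound larger than needed give the
same convolution, because F(0) = 0; this links the sums over i, j, k >= 1 to
[fib_conv]. *)
Lemma sum_fib_convE (a : nat -> nat) (m n : nat) : m <= n ->
  \sum_(1 <= i < n.+1) fib i * (if i <= m then a (m - i) else 0) = fib_conv a m.
Proof.
move=> mn; rewrite /fib_conv [RHS]big_ltn // mul0n add0n.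
rewrite (@big_cat_nat _ _ _ m.+1) //= [X in _ + X]big_nat [X in _ + X]big1 ?addn0.
  by apply: eq_big_nat => i /andP[_ im]; rewrite -ltnS im.
by move=> i /andP[im _]; rewrite leqNgt im muln0.
Qed.

Lemma sum_last_index (i j n : nat) :
  \sum_(1 <= k < n.+1 | i + j + k == n) fib i * fib j * fib k =
  fib i * (if i <= n
           then fib j * (if j <= n - i then fib (n - i - j) else 0) else 0).
Proof.
have [ijn|nij] := leqP (i + j) n; last first.
  rewrite big1_seq.
    case: leqP => h; last by rewrite muln0.
    by rewrite ifF ?muln0 //; lia.
  by move=> k /andP[/eqP]; lia.
rewrite !ifT; try lia.
transitivity (\sum_(0 <= k < n.+1 | k == n - i - j) fib i * fib j * fib k).
  rewrite [RHS]big_ltn_cond // muln0 add0n; case: ifP => _; rewrite ?add0n;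
  by apply: eq_bigl => k; lia.
by rewrite big_nat1_eq ifT ?mulnA //; lia.
Qed.

Lemma triple_sumE (n : nat) :
  \sum_(1 <= i < n.+1) \sum_(1 <= j < n.+1)
      \sum_(1 <= k < n.+1 | i + j + k == n) fib i * fib j * fib k =
  fib_conv (fib_conv fib) n.
Proof.
rewrite -(@sum_fib_convE _ n n) //; apply: eq_bigr => i _.
under eq_bigr do rewrite sum_last_index.
rewrite -big_distrr /=; case: ifP => // le; last by rewrite big1.
by rewrite sum_fib_convE ?leq_subr.
Qed.

(** * Largest size *)

Fixpoint staircase (n l : nat) : seq nat :=
  if l is l'.+1 then n :: staircase n.-1 l' else [::].

Lemma size_staircase (n l : nat) : size (staircase n l) = l.
Proof. by elim: l n => //= l IH n; rewrite IH. Qed.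

Lemma sumn_staircase (n l : nat) : l <= n ->
  2 * sumn (staircase n l) + l * l = l * (2 * n + 1).
Proof.
elim: l n => [|l IH] [|n] //= ln; have := IH n ln; nia.
Qed.

Lemma short_strict_staircase (t l : nat) : 2 * l <= t ->
  short_strict t (staircase (t - l) l).
Proof.
move=> lt; have {lt} ln : l <= t - l by lia.
rewrite /short_strict size_staircase; apply/and3P; split.
- case: l ln => //= l; move: (t - l.+1) => n.
  by elim: l n => //= l IH [|n] //= ln; rewrite leqnn IH.
- by move: (t - l) ln => n; elim: l n => //= l IH [|n] //= ln; rewrite IH.
by case: l ln => //= l; lia.
Qed.

(** Strict decrease bounds each part by the corresponding step, whence both
the inequality and its equality case. *)
Lemma sumn_leqif_staircase (n : nat) (la : seq nat) :
  sorted gtn la -> head 0 la <= n ->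
  sumn la <= sumn (staircase n (size la)) ?= iff (la == staircase n (size la)).
Proof.
elim: la n => [|a mu IH] n /=; first by move=> _ _; apply/leqif_refl.
move=> pa an; rewrite eqseq_cons; apply: leqif_add; first exact: leqif_eq.
apply: IH; first exact: path_sorted pa.
by case: mu pa => //= b mu /andP[/= ? _]; lia.
Qed.

Lemma size_le_head (la : seq nat) :
  sorted gtn la -> all (leq 1) la -> size la <= head 0 la.
Proof.
elim: la => //= a [|b mu] IH /=; first by rewrite andbT.
case/andP=> /= ba pb /andP[_ pos].
by have /= := IH pb pos; lia.
Qed.

(** The hypothesis says that s = l(2t+1-3l)/2, the size of the staircase with
l steps starting at t-l. *)
Lemma staircase_optimum (t l s : nat) :
  2 * s + 3 * (l * l) = l * (2 * t + 1) ->
  s <= 'C(t.+1, 2) %/ 3 ?= iff (l == t.+1 %/ 3) || (l == t.+2 %/ 3).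
Proof.
move=> sE; have cE : 2 * 'C(t.+1, 2) = t.+1 * t.
  by rewrite mul2n bin2 -[RHS]odd_double_half /= oddM /= andNb.
have [k [r [r3 tE]]] : exists k r, r < 3 /\ t = 3 * k + r.
  by exists (t %/ 3), (t %% 3); rewrite ltn_mod mulnC -divn_eq.
(* With d the distance from l to k = t/3 rounded down, twice the gap m - s is
   3d^2 plus or minus an explicit affine function of d, in each class of t
   modulo 3. *)
have [d dE] : exists d, l = k + d \/ k = l + d.
  by exists ((l - k) + (k - l)); lia.
move: {cE}('C(_, _)) cE => c cE.
subst t; case: r r3 sE cE => [|[|[|//]]] _ sE cE.
- have {cE} mE : 2 * (c %/ 3) = k * (3 * k + 1) by lia.
  move: (c %/ 3) mE => m mE.
  have mE' : l = k + d /\ 2 * m + d = 2 * s + 3 * (d * d)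
    \/ k = l + d /\ 2 * m = 2 * s + 3 * (d * d) + d by nia.
  by split; case: d {dE sE mE} mE' => [|d]; nia.
- have {cE} mE : 2 * (c %/ 3) = 3 * (k * (k + 1)) by lia.
  move: (c %/ 3) mE => m mE.
  have mE' : l = k + d /\ 2 * m + 3 * d = 2 * s + 3 * (d * d)
    \/ k = l + d /\ 2 * m = 2 * s + 3 * (d * d) + 3 * d by nia.
  by split; case: d {dE sE mE} mE' => [|[|d]]; nia.
have {cE} mE : 2 * (c %/ 3) = (k + 1) * (3 * k + 2) by lia.
move: (c %/ 3) mE => m mE.
have mE' : l = k + d /\ 2 * m + 5 * d = 2 * s + 3 * (d * d) + 2
  \/ k = l + d /\ 2 * m = 2 * s + 3 * (d * d) + 5 * d + 2 by nia.
by split; case: d {dE sE mE} mE' => [|[|d]]; nia.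
Qed.

Lemma sumn_short_strict_leqif (t : nat) (la : seq nat) : short_strict t la ->
  sumn la <= 'C(t.+1, 2) %/ 3
  ?= iff (la == staircase (t - t.+1 %/ 3) (t.+1 %/ 3))
      || (la == staircase (t - t.+2 %/ 3) (t.+2 %/ 3)).
Proof.
case/and3P=> sla pla hla; set l := size la.
have le_l : l <= head 0 la := size_le_head sla pla.
have h1 : head 0 la <= t - l by rewrite /l; lia.
have := sumn_leqif_staircase sla h1; rewrite -/l => s1.
have s2 : sumn (staircase (t - l) l) <= 'C(t.+1, 2) %/ 3
    ?= iff (l == t.+1 %/ 3) || (l == t.+2 %/ 3).
  apply: staircase_optimum.
  have /sumn_staircase : l <= t - l by lia.
  nia.
congr (_ <= _ ?= iff _): (leqif_trans s1 s2).
have sizeE k : la = staircase (t - k) k -> l = k.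
  by rewrite /l => ->; rewrite size_staircase.
apply/andP/orP => [[/eqP laE /orP[/eqP lE|/eqP lE]]|[]/eqP laE].
- by left; rewrite -lE -laE.
- by right; rewrite -lE -laE.
- by rewrite (sizeE _ laE) !eqxx -laE.
by rewrite (sizeE _ laE) !eqxx orbT -laE.
Qed.

Theorem theorem1p2 (t : nat) (ht : 2 <= t) :
  exists S : {fset seq nat},
    (forall la : seq nat, (la \in S) = distinct_core t la) /\
    #|` S|%fset = fib t.+1 /\
    \max_(la <- S) sumn la = 'C(t.+1, 2) %/ 3 /\
    #|` [fset la in S | sumn la == \max_(mu <- S) sumn mu]|%fset
      = (if t == 1 %[mod 3] then 2 else 1) /\
    \sum_(la <- S) sumn la
      = \sum_(1 <= i < t.+2) \sum_(1 <= j < t.+2)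
          \sum_(1 <= k < t.+2 | i + j + k == t.+1) fib i * fib j * fib k /\
    ((\sum_(la <- S) sumn la)%N%:R / (#|` S|%fset)%:R
      = \sum_(1 <= i < t.+2) \sum_(1 <= j < t.+2)
          \sum_(1 <= k < t.+2 | (i + j + k == t.+1)%N)
            (fib i * fib j * fib k)%N%:R / (fib t.+1)%:R :> rat)%R.
Proof.
pose a := t.+1 %/ 3; pose b := t.+2 %/ 3.
pose A := staircase (t - a) a; pose B := staircase (t - b) b.
pose S := [fset la in short_stricts t]%fset.
have memS la : (la \in S) = short_strict t la.
  by rewrite !inE mem_short_stricts.
have permS : perm_eq S (short_stricts t).
  by apply: uniq_perm (fset_uniq S) (uniq_short_stricts t) _ => la; rewrite !inE.
have cardS : #|` S|%fset = fib t.+1.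
  by rewrite -size_short_stricts; apply: perm_size.
have AS : A \in S by rewrite memS short_strict_staircase //; lia.
have BS : B \in S by rewrite memS short_strict_staircase //; lia.
have maxS : \max_(la <- S) sumn la = 'C(t.+1, 2) %/ 3.
  apply/eqP; rewrite eqn_leq; apply/andP; split.
    apply/bigmax_leqP_seq => la; rewrite memS => laS _.
    exact: (sumn_short_strict_leqif laS).1.
  have := AS; rewrite memS => /sumn_short_strict_leqif[_].
  by rewrite eqxx => /eqP <-; apply: leq_bigmax_seq.
have sumS : \sum_(la <- S) sumn la
      = \sum_(1 <= i < t.+2) \sum_(1 <= j < t.+2)
          \sum_(1 <= k < t.+2 | i + j + k == t.+1) fib i * fib j * fib k.
  by rewrite triple_sumE -sum_sumn_short_stricts; apply: perm_big.
exists S; split; first by move=> la; rewrite memS distinct_coreE //; lia.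
do 3![split=> //]; first last.
  split=> //; rewrite cardS sumS !GRing.natr_sum GRing.mulr_suml.
  apply: eq_bigr => i _; rewrite GRing.natr_sum GRing.mulr_suml.
  by apply: eq_bigr => j _; rewrite GRing.natr_sum GRing.mulr_suml.
have -> : [fset la in S | sumn la == \max_(mu <- S) sumn mu]%fset
        = [fset A; B]%fset.
  apply/fsetP => la; rewrite in_fset2 in_fset /= inE /= maxS.
  have [laS|laS] := boolP (la \in S).
    by move: laS; rewrite memS => /sumn_short_strict_leqif[_ ->].
  by apply/esym/negP => /orP[]/eqP laE; rewrite laE ?AS ?BS in laS.
rewrite cardfs2.
have -> : (A == B) = (a == b).
  apply/eqP/eqP => [/(congr1 size)|eq_ab]; first by rewrite !size_staircase.
  by rewrite /A /B eq_ab.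
by rewrite /a /b; case: eqP; case: eqP; lia.
Qed.
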